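(* Let $n\ge 3$ be odd, $h=\frac{n-1}2$, $T\in\mathcal{BC}^{0,1}(V_n)$ and $s\in\mathbb R^{n+1}$. For $\|T\|<|s|$ we have $$\sum_{m=2h}^{+\infty}\ \sum_{\ell=1}^{m-2h+1}K_\ell(m,h)\,T^{m-2h-\ell+1}\,\overline T^{\,\ell-1}\,s^{-1-m}=\gamma_n(s\mathcal I-\overline T)\big(s^2\mathcal I-(T+\overline T)s+T\overline T\big)^{-(h+1)}$$ and $$\sum_{m=2h}^{+\infty}\ \sum_{\ell=1}^{m-2h+1}K_\ell(m,h)\,s^{-1-m}\,T^{m-2h-\ell+1}\,\overline T^{\,\ell-1}=\gamma_n\big(s^2\mathcal I-(T+\overline T)s+T\overline T\big)^{-(h+1)}(s\mathcal I-\overline T),$$ where $$K_\ell(m,h)=4^h(-1)^h\,h\,\frac{(m-\ell-h+1)!\,(\ell+h-2)!}{(\ell-1)!\,(m-\ell-2h+1)!},\qquad \gamma_n=(-1)^{\frac{n-1}2}2^{n-1}\Big[\Big(\tfrac{n-1}2\Big)!\Big]^2 .$$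
   Context: $\mathbb R_n$ is the real Clifford algebra generated by $e_1,\dots,e_n$ with $e_\ell^2=-1$ and $e_\ell e_m+e_me_\ell=0$ for $\ell\neq m$. A point of $\mathbb R^{n+1}$ is identified with the paravector $s=s_0+\sum_{j=1}^n s_je_j$; $|s|^2=\sum_{j=0}^ns_j^2$. $V$ is a real Banach space, $V_n=V\otimes\mathbb R_n$ is the associated two-sided Banach module over $\mathbb R_n$, and $\mathcal B(V_n)$ is the Banach space of bounded right linear operators on $V_n$, with norm $\|\cdot\|$. Clifford numbers act on operators by $(aT)(v)=a\,T(v)$, $(Ta)(v)=T(av)$; products of operators are compositions. $\mathcal{BC}^{0,1}(V_n)$ is the set of paravector operators $T=T_0+\sum_{\ell=1}^n e_\ell T_\ell$ with pairwise commuting components $T_\ell\in\mathcal B(V)$ (acting componentwise on $V_n$), and $\overline T=T_0-\sum_{\ell=1}^n e_\ell T_\ell$. *)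

(* Defs.v *)
From HB Require Import structures.
From mathcomp Require Import all_boot all_order all_algebra.
From mathcomp Require Import all_classical all_reals all_analysis.

Set Implicit Arguments.
Unset Strict Implicit.
Unset Printing Implicit Defensive.

Import Order.TTheory GRing.Theory Num.Theory.
Import numFieldNormedType.Exports.

Local Open Scope classical_set_scope.
Local Open Scope ring_scope.

(* For A = {i_1 < ... < i_r}, e_A = e_{i_1} ... e_{i_r}.  Bringing e_A e_B into
   increasing order costs one sign for every pair (i, j) of A x B with j < i
   (anticommutation) and one for every pair with j = i (e_i^2 = -1); the indices
   left are those of the symmetric difference of A and B. *)
Definition symd n (A B : {set 'I_n}) : {set 'I_n} :=
  [set i | (i \in A) (+) (i \in B)]%SET.

Definition inv_count n (A B : {set 'I_n}) : nat :=
  (\sum_(i in A) \sum_(j in B) (j <= i))%N.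

Definition esign (R : pzRingType) n (A B : {set 'I_n}) : R :=
  (-1) ^+ inv_count A B.

Section Sign.
Context {n : nat}.
Implicit Types A B C D : {set 'I_n}.

Lemma symdA A B C : symd A (symd B C) = symd (symd A B) C.
Proof. by apply/setP => i; rewrite !inE addbA. Qed.

Lemma symdC A B : symd A B = symd B A.
Proof. by apply/setP => i; rewrite !inE addbC. Qed.

Lemma sym0d A : symd finset.set0 A = A.
Proof. by apply/setP => i; rewrite !inE. Qed.

Lemma symdd A : symd A A = finset.set0.
Proof. by apply/setP => i; rewrite !inE addbb. Qed.

Lemma symdK A : involutive (symd A).
Proof. by move=> B; rewrite symdA symdd sym0d. Qed.

Lemma symd_eq A B C : (symd A B == C) = (B == symd A C).
Proof. exact: (can2_eq (symdK A) (symdK A)). Qed.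

Lemma symd_eqr A B C : (symd B A == C) = (B == symd A C).
Proof. by rewrite symdC symd_eq. Qed.

Let par A B := \big[addb/false]_i \big[addb/false]_j
  [&& i \in A, j \in B & (j <= i)%N].

Let odd_inv_count A B : odd (inv_count A B) = par A B.
Proof.
rewrite /inv_count /par (big_morph odd oddD (erefl _)) big_mkcond /=.
apply: eq_bigr => i _; case: ifPn => _ /=; last by rewrite big1.
rewrite (big_morph odd oddD (erefl _)) big_mkcond /=.
by apply: eq_bigr => j _; case: (j \in B) => //=; case: (_ <= _)%N.
Qed.

Let parDl A B C : par (symd A B) C = par A C (+) par B C.
Proof.
rewrite /par -big_split; apply: eq_bigr => i _ /=.
rewrite -big_split; apply: eq_bigr => j _ /=; rewrite inE.
by case: (i \in A); case: (i \in B); case: (j \in C); case: (_ <= _)%N.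
Qed.

Let parDr A B C : par A (symd B C) = par A B (+) par A C.
Proof.
rewrite /par -big_split; apply: eq_bigr => i _ /=.
rewrite -big_split; apply: eq_bigr => j _ /=; rewrite inE.
by case: (i \in A); case: (j \in B); case: (j \in C); case: (_ <= _)%N.
Qed.

Lemma esign_cocycle (R : pzRingType) A B C :
  esign R A B * esign R (symd A B) C = esign R A (symd B C) * esign R B C.
Proof.
rewrite /esign -(signr_odd _ (inv_count A B)) -(signr_odd _ (inv_count _ C)).
rewrite -(signr_odd _ (inv_count B C)) -(signr_odd _ (inv_count A _)).
by rewrite -!signr_addb !odd_inv_count parDl parDr addbA.
Qed.

Lemma esign0s (R : pzRingType) A : esign R finset.set0 A = 1.
Proof. by rewrite /esign /inv_count big_set0. Qed.

Lemma esigns0 (R : pzRingType) A : esign R A finset.set0 = 1.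
Proof.
by rewrite /esign /inv_count big1 // => i _; rewrite big_set0.
Qed.

End Sign.

Definition cliff (R : pzRingType) (n : nat) : Type := {ffun {set 'I_n} -> R}.

HB.instance Definition _ (R : comNzRingType) n :=
  GRing.Lmodule.copy (cliff R n) {ffun {set 'I_n} -> R^o}.

Definition cle (R : comNzRingType) n (A : {set 'I_n}) : cliff R n :=
  [ffun B => (B == A)%:R].

Definition clgen (R : comNzRingType) n (i : 'I_n) : cliff R n :=
  cle R [set i]%SET.

Definition clmul (R : comNzRingType) n (a b : cliff R n) : cliff R n :=
  [ffun C => \sum_A \sum_(B | symd A B == C) esign R A B * (a A * b B)].

Definition Vn (R : numFieldType) (V : normedModType R) (n : nat) : Type :=
  {ffun {set 'I_n} -> V}.

HB.instance Definition _ (R : numFieldType) (V : normedModType R) n :=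
  GRing.Lmodule.copy (Vn V n) {ffun {set 'I_n} -> V}.

Definition lact (R : numFieldType) (V : normedModType R) n
    (a : cliff R n) (v : Vn V n) : Vn V n :=
  [ffun C => \sum_A \sum_(B | symd A B == C) (esign R A B * a A) *: v B].

Definition ract (R : numFieldType) (V : normedModType R) n
    (v : Vn V n) (a : cliff R n) : Vn V n :=
  [ffun C => \sum_A \sum_(B | symd A B == C) (esign R A B * a B) *: v A].

Section CliffRing.
Context {R : comNzRingType} {n : nat}.
Implicit Types a b c : cliff R n.

Lemma clmulE a b C :
  clmul a b C = \sum_A esign R A (symd A C) * (a A * b (symd A C)).
Proof.
by rewrite ffunE; apply: eq_bigr => A _; rewrite (big_pred1 (symd A C)) // => B;
   rewrite symd_eq.
Qed.

Lemma clmulA : associative (@clmul R n).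
Proof.
move=> a b c; apply/ffunP => D; rewrite !clmulE.
transitivity (\sum_A \sum_B esign R A (symd A D) * (a A *
   (esign R B (symd B (symd A D)) * (b B * c (symd B (symd A D)))))).
  by apply: eq_bigr => A _; rewrite clmulE !mulr_sumr.
symmetry.
under eq_bigr => X _ do rewrite clmulE mulr_suml mulr_sumr.
rewrite exchange_big; apply: eq_bigr => A _ /=.
rewrite (reindex_inj (inv_inj (symdK A))); apply: eq_bigr => B _ /=.
rewrite symdK.
have -> : symd (symd A B) D = symd B (symd A D) by rewrite symdA (symdC A B).
set Z := symd B (symd A D).
have -> : symd A D = symd B Z by rewrite symdK.
have H := esign_cocycle R A B Z.
rewrite !(mulrCA (a A)) !mulrA -H (mulrC (esign _ _ Z)).
by rewrite -!mulrA (mulrCA (a A)).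
Qed.

Lemma cl1mul : left_id (cle R finset.set0) (@clmul R n).
Proof.
move=> a; apply/ffunP => D; rewrite clmulE (bigD1 finset.set0) //= sym0d esign0s.
rewrite big1 ?addr0; first by rewrite ffunE eqxx !mul1r.
by move=> A /negbTE A0; rewrite ffunE A0 mul0r mulr0.
Qed.

Lemma clmul1 : right_id (cle R finset.set0) (@clmul R n).
Proof.
move=> a; apply/ffunP => D; rewrite clmulE (bigD1 D) //= symdd esigns0.
rewrite big1 ?addr0; first by rewrite ffunE eqxx mulr1 mul1r.
move=> A AD; rewrite ffunE symd_eq (symdC A finset.set0) sym0d eq_sym (negbTE AD).
by rewrite !mulr0.
Qed.

Lemma clmulDl : left_distributive (@clmul R n) +%R.
Proof.
move=> a b c; apply/ffunP => D; rewrite [RHS]ffunE !clmulE -big_split.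
by apply: eq_bigr => A _; rewrite ffunE mulrDl mulrDr.
Qed.

Lemma clmulDr : right_distributive (@clmul R n) +%R.
Proof.
move=> a b c; apply/ffunP => D; rewrite [RHS]ffunE !clmulE -big_split.
by apply: eq_bigr => A _; rewrite ffunE !mulrDr.
Qed.

Lemma cl1_neq0 : cle R (finset.set0 : {set 'I_n}) != 0.
Proof.
by apply/eqP => /ffunP /(_ finset.set0); rewrite !ffunE eqxx => /eqP; rewrite oner_eq0.
Qed.

End CliffRing.

HB.instance Definition _ (R : comNzRingType) n :=
  GRing.Zmodule_isNzRing.Build (cliff R n)
    clmulA cl1mul clmul1 clmulDl clmulDr cl1_neq0.

Lemma clscaleAl (R : comNzRingType) n (k : R) (a b : cliff R n) :
  k *: (a * b) = (k *: a) * b.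
Proof.
apply/ffunP => D; rewrite [LHS]ffunE [X in _ *: X]clmulE [RHS]clmulE.
rewrite scaler_sumr; apply: eq_bigr => A _; rewrite ffunE /GRing.scale /=.
by rewrite mulrCA -mulrA.
Qed.

Lemma clscaleAr (R : comNzRingType) n (k : R) (a b : cliff R n) :
  k *: (a * b) = a * (k *: b).
Proof.
apply/ffunP => D; rewrite [LHS]ffunE [X in _ *: X]clmulE [RHS]clmulE.
rewrite scaler_sumr; apply: eq_bigr => A _; rewrite ffunE /GRing.scale /=.
by rewrite mulrCA (mulrCA k).
Qed.

HB.instance Definition _ (R : comNzRingType) n :=
  GRing.Lmodule_isLalgebra.Build R (cliff R n) (@clscaleAl R n).
HB.instance Definition _ (R : comNzRingType) n :=
  GRing.Lalgebra_isAlgebra.Build R (cliff R n) (@clscaleAr R n).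

Section CliffUnit.
Context (R : comNzRingType) (n : nat).
Implicit Types a b : cliff R n.

Definition clinv_spec a : set (cliff R n) := [set b | b * a = 1 /\ a * b = 1].
Definition clunit a : bool := `[< exists b, clinv_spec a b >].
Definition clinv a : cliff R n := xget a (clinv_spec a).

Lemma clinvP a : clunit a -> clinv_spec a (clinv a).
Proof. by move=> /asboolP [b ab]; apply: (xgetI _ ab). Qed.

Lemma clmulVr : {in clunit, left_inverse 1 clinv *%R}.
Proof. by move=> a /clinvP []. Qed.

Lemma cldivrr : {in clunit, right_inverse 1 clinv *%R}.
Proof. by move=> a /clinvP []. Qed.

Lemma clunitP a b : b * a = 1 /\ a * b = 1 -> clunit a.
Proof. by move=> ab; apply/asboolP; exists b. Qed.

Lemma clinv_out : {in [predC clunit], clinv =1 id}.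
Proof.
move=> a aN; rewrite /clinv; case: xgetP => // b _ ab.
by move: aN; rewrite inE => /negP []; exact: clunitP ab.
Qed.

End CliffUnit.

HB.instance Definition _ (R : comNzRingType) n :=
  GRing.NzRing_hasMulInverse.Build (cliff R n)
    (@clmulVr R n) (@cldivrr R n) (@clunitP R n) (@clinv_out R n).

Section CliffRelations.
Context (R : comNzRingType) (n : nat).

Lemma cle0 : cle R (finset.set0 : {set 'I_n}) = 1. Proof. by []. Qed.

Lemma cleM (A B : {set 'I_n}) :
  cle R A * cle R B = esign R A B *: cle R (symd A B).
Proof.
apply/ffunP => C; rewrite [LHS]clmulE (bigD1 A) //= !ffunE eqxx mul1r.
rewrite big1 ?addr0 => [|D /negbTE DA]; last by rewrite ffunE DA mul0r mulr0.
rewrite symd_eq eq_sym eq_sym [C == _]eq_sym.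
by case: eqP => [<-|]; rewrite ?symdK ?mulr0 // /GRing.scale /= ?mulr0.
Qed.

Lemma clgen_sqr (i : 'I_n) : clgen R i ^+ 2 = -1.
Proof.
rewrite expr2 cleM symdd cle0 /esign /inv_count !big_set1 leqnn expr1.
by rewrite scaleN1r.
Qed.

Lemma clgen_anticomm (i j : 'I_n) : i != j ->
  clgen R i * clgen R j + clgen R j * clgen R i = 0.
Proof.
move=> ij; rewrite !cleM (symdC [set j]%SET) -scalerDl.
rewrite /esign /inv_count !big_set1.
have : i != j :> nat by [].
by case: ltngtP => // _ _; rewrite ?expr0 ?expr1 ?subrr ?addNr scale0r.
Qed.

Lemma cle_setU1 (i : 'I_n) (A : {set 'I_n}) :
  (forall j, j \in A -> (i < j)%N) -> cle R (i |: A)%SET = clgen R i * cle R A.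
Proof.
move=> iA; rewrite cleM /esign /inv_count big_set1 big1 => [|j jA]; last first.
  by rewrite leqNgt iA.
rewrite expr0 scale1r; congr (cle R _); apply/setP => j; rewrite !inE.
by case: eqP => //= ->; case: (boolP (i \in A)) => // /iA; rewrite ltnn.
Qed.

End CliffRelations.

Section Module.
Context {R : realType} {V : completeNormedModType R} {n : nat}.
Implicit Types (a b : cliff R n) (u v : Vn V n).

Lemma lactE a v C :
  lact a v C = \sum_A (esign R A (symd A C) * a A) *: v (symd A C).
Proof.
by rewrite ffunE; apply: eq_bigr => A _; rewrite (big_pred1 (symd A C)) // => B;
   rewrite symd_eq.
Qed.

Lemma ractE v a C :
  ract v a C = \sum_A (esign R A (symd A C) * a (symd A C)) *: v A.
Proof.
by rewrite ffunE; apply: eq_bigr => A _; rewrite (big_pred1 (symd A C)) // => B;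
   rewrite symd_eq.
Qed.

Lemma lactDr a : {morph @lact R V n a : u v / u + v}.
Proof.
move=> u v; apply/ffunP => C; rewrite [RHS]ffunE !lactE -big_split.
by apply: eq_bigr => A _; rewrite ffunE scalerDr.
Qed.

Lemma lactDl a b v : lact (a + b) v = lact a v + lact b v.
Proof.
apply/ffunP => C; rewrite [RHS]ffunE !lactE -big_split.
by apply: eq_bigr => A _; rewrite ffunE mulrDr scalerDl.
Qed.

Lemma ractDl a : {morph (fun v : Vn V n => ract v a) : u v / u + v}.
Proof.
move=> u v; apply/ffunP => C; rewrite [RHS]ffunE !ractE -big_split.
by apply: eq_bigr => A _; rewrite ffunE scalerDr.
Qed.

Lemma ractZl k v a : ract (k *: v) a = k *: ract v a.
Proof.
apply/ffunP => C; rewrite [RHS]ffunE !ractE scaler_sumr.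
by apply: eq_bigr => A _; rewrite ffunE !scalerA mulrC.
Qed.

Lemma ract0l a : ract (0 : Vn V n) a = 0.
Proof. by have := ractZl 0 0 a; rewrite !scale0r. Qed.

Lemma ract_alg v (k : R) : ract v k%:A = k *: v.
Proof.
have kE B : (k%:A : cliff R n) B = k * (B == finset.set0)%:R.
  by rewrite ffunE -cle0 ffunE.
apply/ffunP => C; rewrite [RHS]ffunE ractE (bigD1 C) //= symdd esigns0.
rewrite big1 ?addr0; first by rewrite mul1r kE eqxx mulr1.
move=> A AC; rewrite kE symd_eq (symdC A finset.set0) sym0d.
by rewrite eq_sym (negbTE AC) !mulr0 scale0r.
Qed.

Lemma lact_ract a v b : ract (lact a v) b = lact a (ract v b).
Proof.
apply/ffunP => D; rewrite ractE lactE.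
transitivity (\sum_A \sum_B ((esign R A (symd A D) * a A) *:
   ((esign R B (symd B (symd A D)) * b (symd B (symd A D))) *: v B))); last first.
  by apply: eq_bigr => A _; rewrite ractE scaler_sumr.
under eq_bigr => X _ do rewrite lactE scaler_sumr.
rewrite exchange_big; apply: eq_bigr => A _ /=.
rewrite (reindex_inj (inv_inj (symdK A))); apply: eq_bigr => B _ /=.
rewrite symdK !scalerA; congr (_ *: _).
have -> : symd (symd A B) D = symd B (symd A D) by rewrite symdA (symdC A B).
set Z := symd B (symd A D).
have -> : symd A D = symd B Z by rewrite symdK.
have H := esign_cocycle R A B Z.
by rewrite mulrACA (mulrC (esign _ _ Z)) H [RHS]mulrACA (mulrC (a A)).
Qed.

Lemma lact_l1_bound a v :
  \sum_C `|lact a v C| <= (\sum_A `|a A|) * \sum_A `|v A|.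
Proof.
rewrite mulr_suml.
apply: (@le_trans _ _ (\sum_C \sum_A `|a A| * `|v (symd A C)|)).
  apply: ler_sum => C _; rewrite lactE; apply: (le_trans (ler_norm_sum _ _ _)).
  apply: ler_sum => A _; rewrite normrZ normrM.
  by rewrite /esign normrX normrN1 expr1n mul1r.
rewrite exchange_big; apply: ler_sum => A _ /=.
by rewrite -mulr_sumr (reindex_inj (inv_inj (symdK A))); under eq_bigr do rewrite symdK.
Qed.

End Module.

(* No particular norm on the tensor product is singled out: any norm that is
   equivalent to the sum of the norms of the coordinates is admitted.  These are
   exactly the norms for which V_n is complete and v |-> v e_A is bounded from V
   to V_n, and the actions of R_n are bounded for all of them. *)
Record Vn_norm (R : realType) (V : completeNormedModType R) (n : nat) := VnNorm {
  vnorm :> Vn V n -> R;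
  vnormD : forall u v, vnorm (u + v) <= vnorm u + vnorm v;
  vnormZ : forall (k : R) v, vnorm (k *: v) = `|k| * vnorm v;
  vnorm_lb : exists2 c : R, 0 < c & forall v : Vn V n, c * \sum_A `|v A| <= vnorm v;
  vnorm_ub : exists2 c : R, 0 < c & forall v : Vn V n, vnorm v <= c * \sum_A `|v A| }.

Section SumNorm.
Context (R : realType) (V : completeNormedModType R) (n : nat).

Let l1 (v : Vn V n) : R := \sum_A `|v A|.

Let l1D (u v : Vn V n) : l1 (u + v) <= l1 u + l1 v.
Proof. by rewrite /l1 -big_split; apply: ler_sum => A _; rewrite ffunE ler_normD. Qed.

Let l1Z (k : R) (v : Vn V n) : l1 (k *: v) = `|k| * l1 v.
Proof. by rewrite /l1 mulr_sumr; apply: eq_bigr => A _; rewrite ffunE normrZ. Qed.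

Let l1_lb : exists2 c : R, 0 < c & forall v : Vn V n, c * \sum_A `|v A| <= l1 v.
Proof. by exists 1 => // v; rewrite mul1r. Qed.

Let l1_ub : exists2 c : R, 0 < c & forall v : Vn V n, l1 v <= c * \sum_A `|v A|.
Proof. by exists 1 => // v; rewrite mul1r. Qed.

Definition sum_norm : Vn_norm V n := VnNorm l1D l1Z l1_lb l1_ub.

End SumNorm.

Section BoundedOperators.
Context {R : realType} {V : completeNormedModType R} {n : nat}.

Definition right_linear (f : Vn V n -> Vn V n) : Prop :=
  (forall u v, f (u + v) = f u + f v) /\
  (forall v a, f (ract v a) = ract (f v) a).

Definition bounded_op (N : Vn_norm V n) (f : Vn V n -> Vn V n) : Prop :=
  exists M, forall v, N (f v) <= M * N v.

Definition is_bop (N : Vn_norm V n) : {pred Vn V n -> Vn V n} :=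
  fun f => `[< right_linear f /\ bounded_op N f >].

Record bop (N : Vn_norm V n) := Bop {
  bop_fun :> Vn V n -> Vn V n;
  bopP : bop_fun \in is_bop N }.

HB.instance Definition _ N := [isSub for @bop_fun N].
HB.instance Definition _ N := [Choice of bop N by <:].

Variable N : Vn_norm V n.
Implicit Types (f g : bop N) (u v : Vn V n).

Lemma vnorm0 : N 0 = 0.
Proof. by rewrite -(scale0r (0 : Vn V n)) vnormZ normr0 mul0r. Qed.

Lemma vnorm_ge0 v : 0 <= N v.
Proof.
have [c c0 /(_ v)] := vnorm_lb N; apply: le_trans.
by rewrite mulr_ge0 ?(ltW c0) // sumr_ge0.
Qed.

Lemma vnorm_eq0 v : N v = 0 -> v = 0.
Proof.
have [c c0 /(_ v)] := vnorm_lb N => + Nv; rewrite Nv pmulr_rle0 // => le0.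
have /eqP : \sum_A `|v A| = 0 by apply/eqP; rewrite eq_le le0 sumr_ge0.
rewrite psumr_eq0 // => /allP v0; apply/ffunP => A; rewrite [RHS]ffunE.
by apply/eqP; rewrite -normr_eq0; apply: v0; rewrite mem_index_enum.
Qed.

Lemma bounded_opW (f : Vn V n -> Vn V n) :
  bounded_op N f -> exists2 M, 0 <= M & forall v, N (f v) <= M * N v.
Proof.
move=> [M Mf]; exists `|M| => // v.
by apply: (le_trans (Mf v)); rewrite ler_wpM2r ?vnorm_ge0 ?ler_norm.
Qed.

Lemma bounded_op_l1 (f : Vn V n -> Vn V n) M : 0 <= M ->
  (forall v, \sum_A `|f v A| <= M * \sum_A `|v A|) -> bounded_op N f.
Proof.
move=> M0 Mf; have [c c0 cN] := vnorm_lb N; have [d d0 dN] := vnorm_ub N.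
exists (d * M / c) => v; apply: (le_trans (dN _)).
rewrite -!mulrA ler_pM2l //; apply: (le_trans (Mf v)).
by rewrite ler_wpM2l // ler_pdivlMl.
Qed.

Lemma is_bop_submod : submod_closed (is_bop N).
Proof.
split=> [|k f g /asboolP[[fD fr] fb] /asboolP[[gD gr] gb]]; apply/asboolP.
  split; first by split=> [u v|v a]; rewrite /= ?addr0 ?ract0l.
  by exists 0 => v; rewrite /= vnorm0 mul0r.
have [M M0 Mf] := bounded_opW fb; have [M' M'0 Mg] := bounded_opW gb.
split; first split=> [u v|v a].
- by rewrite !fctE fD gD scalerDr addrACA.
- by rewrite !fctE fr gr ractDl ractZl.
exists (`|k| * M + M') => v; rewrite !fctE; apply: (le_trans (vnormD _ _ _)).
by rewrite vnormZ mulrDl -mulrA lerD // ler_wpM2l.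
Qed.

HB.instance Definition _ :=
  GRing.isSubmodClosed.Build R (Vn V n -> Vn V n) (is_bop N) is_bop_submod.

End BoundedOperators.

HB.instance Definition _ (R : realType) (V : completeNormedModType R) n
    (N : Vn_norm V n) :=
  [SubChoice_isSubLmodule of bop N by <:].

Section OperatorRing.
Context {R : realType} {V : completeNormedModType R} {n : nat}.
Context {N : Vn_norm V n}.
Implicit Types (f g : bop N) (u v : Vn V n).

Lemma bopD f g v : (f + g) v = f v + g v. Proof. by []. Qed.
Lemma bopZ (k : R) f v : (k *: f) v = k *: f v. Proof. by []. Qed.

Lemma bop_ext f g : (forall v, f v = g v) -> f = g.
Proof. by move=> fg; apply/val_inj/funext. Qed.

Lemma bop_add f u v : f (u + v) = f u + f v.
Proof. by have /asboolP[[]] := bopP f. Qed.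

Lemma bop_ract f v a : f (ract v a) = ract (f v) a.
Proof. by have /asboolP[[]] := bopP f. Qed.

Lemma bop_scale f k v : f (k *: v) = k *: f v.
Proof. by have := bop_ract f v k%:A; rewrite !ract_alg. Qed.

Lemma bop_map0 f : f 0 = 0.
Proof. by have := bop_scale f 0 0; rewrite !scale0r. Qed.

Lemma bop_bounded f : exists2 M, 0 <= M & forall v, N (f v) <= M * N v.
Proof. by have /asboolP[_ /bounded_opW] := bopP f. Qed.

Lemma bop1_subproof : idfun \in is_bop N.
Proof. by apply/asboolP; split=> //; exists 1 => v; rewrite mul1r. Qed.

Definition bop1 : bop N := Bop bop1_subproof.

Lemma bopM_subproof f g : f \o g \in is_bop N.
Proof.
apply/asboolP; split.
  by split=> [u v|v a] /=; rewrite ?bop_add ?bop_ract.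
have [M M0 Mf] := bop_bounded f; have [M' M'0 Mg] := bop_bounded g.
by exists (M * M') => v /=; apply: (le_trans (Mf _)); rewrite -mulrA ler_wpM2l.
Qed.

Definition bopM f g : bop N := Bop (bopM_subproof f g).

Lemma bopMA : associative bopM. Proof. by move=> f g k; apply: bop_ext. Qed.
Lemma bop1M : left_id bop1 bopM. Proof. by move=> f; apply: bop_ext. Qed.
Lemma bopM1 : right_id bop1 bopM. Proof. by move=> f; apply: bop_ext. Qed.
Lemma bopMDl : left_distributive bopM +%R.
Proof. by move=> f g k; apply: bop_ext. Qed.
Lemma bopMDr : right_distributive bopM +%R.
Proof. by move=> f g k; apply: bop_ext => v; rewrite bopD /= bop_add. Qed.

End OperatorRing.

HB.instance Definition _ (R : realType) (V : completeNormedModType R) n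
    (N : Vn_norm V n) :=
  GRing.Zmodule_isPzRing.Build (bop N)
    (@bopMA _ _ _ N) bop1M bopM1 bopMDl bopMDr.

Definition opnorm (R : realType) (V : completeNormedModType R) n
    (N : Vn_norm V n) (f : bop N) : R :=
  sup [set N (f v) | v in [set v | N v <= 1]].

Section OperatorNorm.
Context {R : realType} {V : completeNormedModType R} {n : nat}.
Context {N : Vn_norm V n}.
Implicit Types (f g : bop N) (u v : Vn V n).

Lemma opnorm_has_sup f : has_sup [set N (f v) | v in [set v | N v <= 1]].
Proof.
split; first by exists (N (f 0)); exists 0; rewrite //= vnorm0 ler01.
have [M M0 Mf] := bop_bounded f; exists M => _ [v /= v1 <-].
by apply: (le_trans (Mf v)); rewrite -{2}(mulr1 M) ler_wpM2l.
Qed.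

Lemma opnorm_le f M : (forall v, N v <= 1 -> N (f v) <= M) -> opnorm f <= M.
Proof.
move=> fM; apply: ge_sup; first exact: (opnorm_has_sup f).1.
by move=> _ [v /= v1 <-]; exact: fM.
Qed.

Lemma opnorm_ub1 f v : N v <= 1 -> N (f v) <= opnorm f.
Proof. by move=> v1; apply: (ub_le_sup (opnorm_has_sup f).2); exists v. Qed.

Lemma opnorm_ge0 f : 0 <= opnorm f.
Proof. by apply: (le_trans (vnorm_ge0 N (f 0))); rewrite opnorm_ub1 ?vnorm0. Qed.

Lemma opnorm_ub f v : N (f v) <= opnorm f * N v.
Proof.
have [/vnorm_eq0 ->|v0] := eqVneq (N v) 0.
  by rewrite bop_map0 vnorm0 mulr0.
have vp : 0 < N v by rewrite lt_neqAle eq_sym v0 vnorm_ge0.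
have /(opnorm_ub1 f) : N ((N v)^-1 *: v) <= 1.
  by rewrite vnormZ gtr0_norm ?invr_gt0 // mulVf.
by rewrite bop_scale vnormZ gtr0_norm ?invr_gt0 // ler_pdivrMl // mulrC.
Qed.

Lemma opnormD f g : opnorm (f + g) <= opnorm f + opnorm g.
Proof.
apply: opnorm_le => v v1; rewrite bopD; apply: (le_trans (vnormD _ _ _)).
by rewrite lerD ?opnorm_ub1.
Qed.

Lemma opnormZ (k : R) f : opnorm (k *: f) = `|k| * opnorm f.
Proof.
have le1 (l : R) g : opnorm (l *: g) <= `|l| * opnorm g.
  by apply: opnorm_le => v v1; rewrite bopZ vnormZ ler_wpM2l ?opnorm_ub1.
apply/eqP; rewrite eq_le le1 /=.
have [->|k0] := eqVneq k 0; first by rewrite normr0 mul0r opnorm_ge0.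
have := le1 k^-1 (k *: f).
by rewrite scalerA mulVf // scale1r normfV ler_pdivlMl ?normr_gt0.
Qed.

Lemma opnorm_eq0 f : opnorm f = 0 -> f = 0.
Proof.
move=> f0; apply: bop_ext => v; apply: (@vnorm_eq0 _ _ _ N); apply/eqP.
by rewrite eq_le vnorm_ge0 andbT -[X in _ <= X](mul0r (N v)) -f0 opnorm_ub.
Qed.

End OperatorNorm.

HB.instance Definition _ (R : realType) (V : completeNormedModType R) n
    (N : Vn_norm V n) :=
  Lmodule_isNormed.Build R (bop N) opnormD opnormZ opnorm_eq0.

Section Operators.
Context {R : realType} {V : completeNormedModType R} {n : nat}.
Context (N : Vn_norm V n).

Lemma clop_subproof (a : cliff R n) : @lact R V n a \in is_bop N.
Proof.
apply/asboolP; split; first by split=> [u v|v b]; rewrite ?lactDr ?lact_ract.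
apply: (@bounded_op_l1 _ _ _ N _ (\sum_A `|a A|)); first exact: sumr_ge0.
exact: lact_l1_bound.
Qed.

(* a I, so that a T = clop a * T and T a = T * clop a. *)
Definition clop (a : cliff R n) : bop N := Bop (clop_subproof a).

Definition cwise (f : V -> V) (v : Vn V n) : Vn V n := [ffun A => f (v A)].

Lemma cwise_subproof (f : {linear V -> V}) :
  continuous f -> cwise f \in is_bop N.
Proof.
move=> /linear_bounded_continuous/linear_boundedP /pinfty_ex_gt0[M M0 fM].
apply/asboolP; split; first split=> [u v|v a].
- by apply/ffunP => A; rewrite !ffunE linearD.
- apply/ffunP => A; rewrite ffunE !ractE linear_sum.
  by apply: eq_bigr => B _; rewrite linearZ ffunE.
apply: (@bounded_op_l1 _ _ _ N _ M); first exact: ltW.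
by move=> v; rewrite mulr_sumr; apply: ler_sum => A _; rewrite ffunE fM.
Qed.

Definition cwop (f : {linear V -> V}) (fc : continuous f) : bop N :=
  Bop (cwise_subproof fc).

End Operators.

(* The operators T = T_0 + \sum_l e_l T_l of BC^{0,1}(V_n), given by their
   components; the component T_l sits at index l of 'I_n.+1. *)
Record BC01 (R : realType) (V : completeNormedModType R) (n : nat) := {
  component : 'I_n.+1 -> {linear V -> V};
  component_continuous : forall l, continuous (component l);
  component_commute : forall l m x,
    component l (component m x) = component m (component l x) }.

Section Paravectors.
Context {R : realType} {V : completeNormedModType R} {n : nat}.

Definition component_op (N : Vn_norm V n) (T : BC01 V n) (l : 'I_n.+1) : bop N :=
  cwop N (@component_continuous R V n T l).

Definition pvop (N : Vn_norm V n) (T : BC01 V n) : bop N :=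
  component_op N T ord0
  + \sum_(l < n) clop N (clgen R l) * component_op N T (lift ord0 l).

Definition pvop_conj (N : Vn_norm V n) (T : BC01 V n) : bop N :=
  component_op N T ord0
  - \sum_(l < n) clop N (clgen R l) * component_op N T (lift ord0 l).

Definition pv (s : 'rV[R]_n.+1) : cliff R n :=
  (s 0 ord0)%:A + \sum_(j < n) s 0 (lift ord0 j) *: clgen R j.

Definition enorm (s : 'rV[R]_n.+1) : R := Num.sqrt (\sum_j s 0 j ^+ 2).

End Paravectors.

(* The differences are written so that natural-number subtraction never
   truncates on the range 1 <= l <= m - 2h + 1, h >= 1 where K is used. *)
Definition Kcoef (R : realType) (l m h : nat) : R :=
  4 ^+ h * (-1) ^+ h * h%:R
  * (((m + 1 - l - h)`! * (l + h - 2)`!)%:R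
     / ((l - 1)`! * (m + 1 - l - 2 * h)`!)%:R).

Definition gamma_n (R : realType) (n : nat) : R :=
  (-1) ^+ ((n - 1) %/ 2) * 2 ^+ (n - 1) * (((n - 1) %/ 2)`!)%:R ^+ 2.

(* Main.v *)
Require Import Defs.
From HB Require Import structures.
From mathcomp Require Import all_boot all_order all_algebra.
From mathcomp Require Import all_classical all_reals all_analysis.
From mathcomp Require Import zify ring.

Set Implicit Arguments.
Unset Strict Implicit.
Unset Printing Implicit Defensive.

Import Order.TTheory GRing.Theory Num.Theory.
Import numFieldNormedType.Exports.

Local Open Scope classical_set_scope.
Local Open Scope ring_scope.

(** Suppose first that t, u and s are commuting variables.  Multiplying the
negative binomial series of (s - t)^-(h+1) and (s - u)^-h gives
  sum over a, b of C(a+h, h) C(b+h-1, h-1) t^a u^b s^(-a-b-2h-1),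
and gamma_n times the coefficient of this product is K_l(m, h) for l = b + 1 and
m = a + b + 2h.  So the series of the theorem is gamma_n (s - t)^-(h+1) (s - u)^-h,
that is gamma_n (s - u) ((s - t)(s - u))^-(h+1).

The operators T and Tbar commute with each other but not with s.  What does
commute are the maps X |-> T X, X |-> Tbar X and X |-> X s of B(V_n), and the first
series is the value at 1 of the commutative expression in these maps.  The product
of the maps (X |-> X s - T X) and (X |-> X s - Tbar X) sends X to
X s^2 - (T + Tbar) X s + T Tbar X, which is X Q as soon as X commutes with
T + Tbar = 2 T_0 and T Tbar = sum of the T_l^2.  These two operators commute with
all of T, Tbar and the Clifford numbers, because the components T_l do
([pvop_trace], [pvop_norm], [clop_component_comm]).

The identity is established through recurrences.  Let S i j be the sum with
exponents i and j in place of h+1 and h.  Pascal's rule makes the partial sums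
satisfy a recurrence ([series_dterm]) that becomes in the limit
  S (i+1) j * s = T * S (i+1) j + S i j,   S i (j+1) * s = Tbar * S i (j+1) + S i j
([dsumSl], [dsumSr]), whence S (i+1) (j+1) * Q = S i j ([factor_step]).  With
S 0 0 = 1 this yields S 1 1 * Q = 1 and S (h+1) h * Q^(h+1) = s - Tbar.  The second
series gives in the same way, in the converse ring, a right inverse of Q; the two
inverses agree and both formulas follow.

Convergence rests on |T^a Tbar^b s^-p| <= C |T|^(a+b) |s|^-p.  As the norm of V_n is
only known up to equivalence, |Tbar| <= |T| cannot be expected; but the grade
involution conjugates T into Tbar, so the powers of Tbar are bounded by those of
|T| up to a constant ([pvop_conjX_bound]).  Multiplication by a paravector s
multiplies the Euclidean norm of the Clifford algebra by |s| ([cldot_pv]), which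
controls the powers of s^-1.  A normally convergent series of operators converges
because B(V_n) is complete ([bop_complete]). *)

(** * Double negative binomial series *)

(** The coefficient of x^a in (1 - x)^-i; for i = 0 the predecessor makes it the
Kronecker delta at a = 0, as it should be. *)
Definition negbin (i a : nat) : nat := 'C((a + i).-1, a).

Lemma negbin0 i : negbin i 0 = 1%N. Proof. exact: bin0. Qed.

Lemma negbin0S a : negbin 0 a.+1 = 0%N.
Proof. by rewrite /negbin addn0 bin_small. Qed.

(** The identity (1 - x)^-(i+1) (1 - x) = (1 - x)^-i, coefficient by coefficient. *)
Lemma negbinSS i a : negbin i.+1 a.+1 = (negbin i.+1 a + negbin i a.+1)%N.
Proof. by rewrite /negbin !addnS !addSn /= binS addnC. Qed.

Section DoubleTerms.
Context {R : nzRingType} {E : lmodType R}.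
Implicit Types W : nat -> nat -> nat -> E.

(** For W a b p = x^a y^b s^-p in commuting variables, this is the part of degree k
in x, y of (s - x)^-i (s - y)^-j.  Only the way in which maps x, y and s shift the
indices of W matters, so that the same sums serve for multiplications on the left,
for multiplications on the right, and for real majorants. *)
Definition dterm W i j k : E :=
  \sum_(a < k.+1) (negbin i a * negbin j (k - a))%:R *: W a (k - a)%N (k + i + j)%N.

Lemma dterm_flip W i j k :
  dterm W i j k = dterm (fun a b => W b a) j i k.
Proof.
rewrite /dterm (reindex_inj rev_ord_inj); apply: eq_bigr => a _ /=.
have le_ak : (a <= k)%N by rewrite -ltnS.
by rewrite subSS subKn // mulnC addnAC.
Qed.

Lemma dterm00 W k : dterm W 0 0 k = (k == 0)%:R *: W 0 0 0.
Proof.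
case: k => [|k]; first by rewrite /dterm big_ord1 !addn0 !negbin0.
rewrite scale0r /dterm big1 // => -[[|a] /= lt_ak] _.
  by rewrite negbin0S muln0 scale0r.
by rewrite negbin0S mul0n scale0r.
Qed.

Section Recurrence.
Variables (W : nat -> nat -> nat -> E) (x sg : {linear E -> E}).
Hypothesis xW : forall a b p, x (W a b p) = W a.+1 b p.
Hypothesis sgW : forall a b p, sg (W a b p.+1) = W a b p.

Lemma dtermS0 i j : sg (dterm W i.+1 j 0) = dterm W i j 0.
Proof. by rewrite /dterm !big_ord1 linearZ /= !add0n addSn sgW !negbin0. Qed.

(** Multiplication by s - x lowers the exponent i, by Pascal's rule. *)
Lemma dtermSS i j k :
  sg (dterm W i.+1 j k.+1) = x (dterm W i.+1 j k) + dterm W i j k.+1.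
Proof.
have degE : (k.+1 + i.+1 + j = (k.+1 + i + j).+1)%N by rewrite addnS addSn.
rewrite /dterm !linear_sum /= big_ord_recl [X in _ = _ + X]big_ord_recl.
rewrite addrCA -big_split /=; congr (_ + _).
  by rewrite linearZ /= degE sgW !negbin0.
apply: eq_bigr => a _; rewrite !linearZ /= subSS xW degE sgW addnS -addSn.
by rewrite -scalerDl -natrD -mulnDl /bump /= add1n negbinSS.
Qed.

Lemma series_dterm i j M :
  sg (series (dterm W i.+1 j) M.+1) =
  x (series (dterm W i.+1 j) M) + series (dterm W i j) M.+1.
Proof.
rewrite /series /=; elim: M => [|M IH].
  by rewrite !big_nat1 big_geq // linear0 add0r dtermS0.
rewrite big_nat_recr //= linearD /= IH dtermSS [in RHS]big_nat_recr //= linearD.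
by rewrite [X in _ = _ + X]big_nat_recr //= -!addrA; congr (_ + _); rewrite addrCA.
Qed.

End Recurrence.
End DoubleTerms.

(** Taking W a b p = q^(a+b) gives real terms that dominate all the series below.
Their partial sums are bounded by (1 - q)^-(i+j), by the very recurrence that
governs the exact sums. *)
Section Majorant.
Context {R : realType} (q : R).
Hypotheses (q0 : 0 <= q) (q1 : q < 1).

Let G (a b p : nat) : R^o := q ^+ (a + b).

Lemma majorant_ge0 i j k : 0 <= dterm G i j k :> R.
Proof. by apply: sumr_ge0 => a _; rewrite mulr_ge0 // exprn_ge0. Qed.

(** The recurrence reads S_(i+1)(M+1) = q S_(i+1)(M) + S_i(M+1), and partial sums
of nonnegative terms increase with M. *)
Lemma majorant_step i j M :
  series (dterm G i.+1 j) M <= (1 - q)^-1 * series (dterm G i j) M :> R.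
Proof.
rewrite ler_pdivlMl ?subr_gt0 //; case: M => [|M].
  by rewrite /series /= !big_geq // mulr0.
pose mulq : {linear R^o -> R^o} := GRing.scale q.
have mulqG a b p : mulq (G a b p) = G a.+1 b p by rewrite /G addSn exprS.
have := @series_dterm R R^o G mulq idfun mulqG (fun _ _ _ => erefl) i j M.
rewrite [mulq _]/(q * _) mulrBl mul1r lerBlDl => /= {1}->.
rewrite lerD2r ler_wpM2l // /series /= big_nat_recr //= lerDl.
exact: majorant_ge0.
Qed.

Lemma majorant_bound i j M :
  series (dterm G i j) M <= (1 - q)^-1 ^+ (i + j) :> R.
Proof.
have q1V : 0 <= (1 - q)^-1 by rewrite invr_ge0 subr_ge0 ltW.
have flipG : (fun a b => G b a) = G
  by apply/funext=> a; apply/funext=> b; rewrite /G addnC.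
have step_le i' j' : series (dterm G i' j') M <= (1 - q)^-1 ^+ (i' + j') :> R ->
    series (dterm G i'.+1 j') M <= (1 - q)^-1 ^+ (i'.+1 + j') :> R.
  by move=> le; rewrite addSn exprS (le_trans (majorant_step _ _ _)) ?ler_wpM2l.
have serC i' j' : series (dterm G i' j') M = series (dterm G j' i') M.
  by apply: eq_bigr => k _; rewrite dterm_flip flipG.
elim: i => [|i /step_le //]; elim: j => [|j]; last first.
  by rewrite serC addnC => /step_le; rewrite serC addnC.
rewrite addn0 expr0; case: M {step_le serC} => [|M].
  by rewrite /series /= big_geq.
rewrite /series /= big_nat_recl //= big1 => [|k _]; rewrite dterm00 ?scale0r //.
by rewrite addr0 scale1r /G.
Qed.

Lemma is_cvg_majorant i j : cvgn (series (dterm G i j) : R ^nat).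
Proof.
apply: nondecreasing_is_cvgn; last first.
  by exists ((1 - q)^-1 ^+ (i + j)) => _ [M _ <-]; exact: majorant_bound.
by apply: nondecreasing_series => k _ _; exact: majorant_ge0.
Qed.

End Majorant.

Section DoubleSeries.
Context {R : realType} {E : completeNormedModType R}.
Variables (W : nat -> nat -> nat -> E) (C r t : R).
Hypotheses (r0 : 0 <= r) (t0 : 0 <= t) (rt1 : r * t < 1).
Hypothesis W_le : forall a b p, `|W a b p| <= C * r ^+ (a + b) * t ^+ p.

Lemma is_cvg_dterm i j : cvgn (series (dterm W i j)).
Proof.
have C0 : 0 <= C by have := W_le 0 0 0; rewrite !mulr1; apply: le_trans.
have rt0 : 0 <= r * t by exact: mulr_ge0.
pose G (a b p : nat) : R^o := (r * t) ^+ (a + b).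
have GD k : 0 <= dterm G i j k :> R by exact: majorant_ge0.
pose D := C * t ^+ (i + j); have D0 : 0 <= D by rewrite mulr_ge0 ?exprn_ge0.
apply: normed_cvg; apply: (@series_le_cvg _ _ (fun k => D * (dterm G i j k : R))).
- by move=> k; exact: normr_ge0.
- by move=> k; exact: mulr_ge0.
- move=> k /=; rewrite /dterm mulr_sumr (le_trans (ler_norm_sum _ _ _)) //.
  apply: ler_sum => a _; rewrite normrZ normr_nat mulrCA ler_wpM2l //.
  apply: (le_trans (W_le _ _ _)).
  have ak : (a <= k)%N by rewrite -ltnS.
  rewrite /G subnKC // -addnA exprD exprMn /D.
  by rewrite le_eqVlt; apply/orP; left; apply/eqP; ring.
- rewrite (_ : series _ = D *: (series (dterm G i j) : R ^nat)).
    by apply: is_cvgZl_tmp; exact: is_cvg_majorant.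
  by apply/funext => M; rewrite /series /= -mulr_sumr.
Qed.

Definition dsum i j : E := limn (series (dterm W i j)).

Lemma dsum_cvg i j : series (dterm W i j) @ \oo --> dsum i j.
Proof. exact: is_cvg_dterm. Qed.

Lemma dsum_flip i j : dsum i j = limn (series (dterm (fun a b => W b a) j i)).
Proof.
by congr (limn (series _)); apply/funext => k; exact: dterm_flip.
Qed.

Lemma dsum00 : dsum 0 0 = W 0 0 0.
Proof.
apply: cvg_lim => //; rewrite -cvg_shiftS /=.
rewrite (_ : (fun M => series (dterm W 0 0) M.+1) = cst (W 0 0 0)).
  exact: cvg_cst.
apply/funext => M; rewrite /series /= big_nat_recl // big1 => [|k _].
  by rewrite dterm00 scale1r addr0.
by rewrite dterm00 scale0r.
Qed.

End DoubleSeries.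

Section DoubleSeriesRecurrence.
Context {R : realType} {E : completeNormedModType R}.
Variables (W : nat -> nat -> nat -> E) (C r t : R).
Hypotheses (r0 : 0 <= r) (t0 : 0 <= t) (rt1 : r * t < 1).
Hypothesis W_le : forall a b p, `|W a b p| <= C * r ^+ (a + b) * t ^+ p.
Variables (x sg : {linear E -> E}).
Hypotheses (xc : continuous x) (sgc : continuous sg).
Hypothesis xW : forall a b p, x (W a b p) = W a.+1 b p.
Hypothesis sgW : forall a b p, sg (W a b p.+1) = W a b p.

(** In the limit, (s - x) (s - x)^-(i+1) (s - y)^-j = (s - x)^-i (s - y)^-j. *)
Lemma dsumSl i j : sg (dsum W i.+1 j) = x (dsum W i.+1 j) + dsum W i j.
Proof.
have cW := dsum_cvg r0 t0 rt1 W_le.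
apply: (@cvg_unique _ _ (sg (series (dterm W i.+1 j) M.+1) @[M --> \oo])) => //.
  apply: continuous_cvg; first exact: sgc.
  by rewrite cvg_shiftS; exact: cW.
rewrite (_ : (fun M => sg _) = (fun M => x (series (dterm W i.+1 j) M)
    + series (dterm W i j) M.+1)); last first.
  by apply/funext => M; exact: series_dterm.
apply: cvgD; first by apply: continuous_cvg; [exact: xc|exact: cW].
by rewrite cvg_shiftS; exact: cW.
Qed.

End DoubleSeriesRecurrence.

Lemma dsumSr {R : realType} {E : completeNormedModType R}
    (W : nat -> nat -> nat -> E) (C r t : R) :
  0 <= r -> 0 <= t -> r * t < 1 ->
  (forall a b p, `|W a b p| <= C * r ^+ (a + b) * t ^+ p) ->
  forall y sg : {linear E -> E}, continuous y -> continuous sg ->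
  (forall a b p, y (W a b p) = W a b.+1 p) ->
  (forall a b p, sg (W a b p.+1) = W a b p) ->
  forall i j, sg (dsum W i j.+1) = y (dsum W i j.+1) + dsum W i j.
Proof.
move=> r0 t0 rt1 W_le y sg yc sgc yW sgW i j; rewrite !dsum_flip.
have W_le' a b p : `|W b a p| <= C * r ^+ (a + b) * t ^+ p by rewrite addnC.
exact: (dsumSl r0 t0 rt1 W_le' yc sgc (fun a b p => yW b a p)
  (fun a b p => sgW b a p)).
Qed.

(** * Completeness of the algebra of bounded operators *)

Section Completeness.
Context {R : realType} {V : completeNormedModType R} {n : nat}.
Context {N : Vn_norm V n}.
Implicit Types (f g : bop N) (u v w : Vn V n).

Lemma normopE f : `|f| = opnorm f. Proof. by []. Qed.

Lemma normopM f g : `|f * g| <= `|f| * `|g|.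
Proof.
apply: opnorm_le => v v1; rewrite normopE.
apply: (le_trans (opnorm_ub f (g v))).
by rewrite ler_wpM2l ?opnorm_ge0 ?opnorm_ub1.
Qed.

Lemma normopX f k : `|f ^+ k| <= `|f| ^+ k.
Proof.
elim: k => [|k IH]; first by rewrite !expr0; apply: opnorm_le.
by rewrite !exprS (le_trans (normopM _ _)) ?ler_wpM2l.
Qed.

Lemma vnormB u v : N (u - v) = N (v - u).
Proof. by rewrite -opprB -scaleN1r vnormZ normrN1 mul1r. Qed.

(** The norm is dominated by the sum of the coordinate norms, so that convergence
of all the coordinates is enough. *)
Lemma vnorm_cvg0 {T} (F : set_system T) {FF : Filter F}
    (x : T -> Vn V n) w :
  (forall A, x t A @[t --> F] --> w A) ->
  forall e, 0 < e -> \forall t \near F, N (x t - w) <= e.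
Proof.
move=> xw e e0; have [d d0 dN] := vnorm_ub N.
have : (\sum_A `|w A - x t A|) @[t --> F] --> (0 : R).
  rewrite [X in _ --> X](_ : 0 = \sum_(A : {set 'I_n}) 0); last by rewrite big1.
  apply: cvg_big => // [|A _]; first exact: add_continuous.
  rewrite -(normr0 V) -(subrr (w A)).
  by apply: cvg_norm; apply: cvgB => //; exact: cvg_cst.
have ed : 0 < e / d by rewrite divr_gt0.
move=> /cvgr_dist_le /(_ _ ed); apply: filterS => t.
rewrite sub0r normrN ger0_norm ?sumr_ge0 // ler_pdivlMr // mulrC => le_e.
rewrite vnormB (le_trans (dN _)) // (le_trans _ le_e) //.
rewrite ler_pM2l // ler_sum // => A _.
by rewrite !ffunE.
Qed.

Lemma vnorm_lim {T} (F : set_system T) {FF : ProperFilter F}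
    (x : T -> Vn V n) u w M :
  (forall A, x t A @[t --> F] --> w A) ->
  (\forall t \near F, N (u - x t) <= M) -> N (u - w) <= M.
Proof.
move=> /vnorm_cvg0 xw xM; apply/ler_addgt0Pr => e /xw {}xw; near F => t.
rewrite -(subrK (x t) u) -addrA (le_trans (vnormD _ _ _)) // lerD //.
  by near: t.
by near: t.
Unshelve. all: by end_near. Qed.

Lemma coord_bound : exists2 K : R, 0 < K &
  forall f v (A : {set 'I_n}), `|f v A| <= K * (`|f| * N v).
Proof.
have [c c0 cN] := vnorm_lb N; exists c^-1; first by rewrite invr_gt0.
move=> f v A; rewrite ler_pdivlMl // (le_trans _ (opnorm_ub f v)) //.
apply: le_trans (cN _); rewrite ler_pM2l // (bigD1 A) //= lerDl.
exact: sumr_ge0.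
Qed.

(** Operators converge when all the coordinates of all their values do, and the
limit inherits right linearity from the finite sums that compute the action of
the Clifford numbers; uniformity of the Cauchy condition makes the convergence
hold in norm. *)
Lemma bop_complete (F : set_system (bop N)) :
  ProperFilter F -> cauchy F -> cvg F.
Proof.
move=> FF Fc; have [K K0 fK] := coord_bound.
have /(_ _ _) /cauchy_cvg cvF v (A : {set 'I_n}) :
    cauchy ((fun f => f v A) @ F).
  apply/cauchy_ballP => e e0; rewrite near_map2.
  (* N v + 1 stands for N v, which may vanish. *)
  have [d d0 dv] : exists2 d, 0 < d & K * (d * N v) < e.
    exists (e / (K * (N v + 1))).
      by rewrite divr_gt0 ?mulr_gt0 // ltr_wpDl ?vnorm_ge0.
    have p1 : 0 < N v + 1 by rewrite ltr_wpDl ?vnorm_ge0.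
    have -> : K * (e / (K * (N v + 1)) * N v) = e * N v / (N v + 1).
      by field; rewrite !gt_eqF.
    by rewrite ltr_pdivrMr // ltr_pM2l // ltrDl.
  have /cauchy_ballP/(_ _ d0) := Fc; apply: filterS => -[f g] /=.
  rewrite -!ball_normE /= => fg; apply: le_lt_trans dv.
  have := fK (f - g) v A; rewrite -[(f - g) v]/(f v - g v) !ffunE => /le_trans.
  by apply; rewrite ler_pM2l // ler_wpM2r ?vnorm_ge0 // ltW.
pose L v : Vn V n := [ffun A => lim ((fun f => f v A) @ F)].
have LE v A : (fun f : bop N => f v A) @ F --> L v A by rewrite ffunE; exact: cvF.
have Llim e : 0 < e -> \forall f \near F, forall v, N ((f : bop N) v - L v) <= e * N v.
  (* The Cauchy bound on f - g is uniform in v, and survives the limit in g. *)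
  move=> e0; have /cauchy_ballP/(_ _ e0)/nearP_dep := Fc.
  apply: filterS => f fF v; apply: (vnorm_lim (LE v)); apply: filterS fF => g.
  rewrite -ball_normE /= => /ltW fg.
  apply: le_trans (opnorm_ub (f - g) v) _.
  by rewrite ler_wpM2r ?vnorm_ge0.
have Lbop : L \in is_bop N.
  apply/asboolP; split; first split=> [u v|v a].
  - apply/ffunP => A; rewrite [RHS]ffunE; apply: (cvg_unique _ (LE (u + v) A)) => //.
    rewrite (_ : (fun f : bop N => _) = (fun f => f u A + f v A)).
      exact: cvgD (LE u A) (LE v A).
    by apply/funext => f; rewrite bop_add ffunE.
  - apply/ffunP => C; apply: (cvg_unique _ (LE (ract v a) C)) => //.
    rewrite (_ : (fun f : bop N => _) = (fun f =>
      \sum_A (esign R A (symd A C) * a (symd A C)) *: f v A)); last first.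
      by apply/funext => f; rewrite bop_ract ractE.
    rewrite ractE.
    apply: cvg_big => // [|A _]; first exact: add_continuous.
    exact: cvgZl_tmp (LE v A).
  near F => f; have [M M0 fM] := bop_bounded f; exists (1 + M) => v.
  rewrite -(subrK (f v) (L v)) mulrDl (le_trans (vnormD _ _ _)) // lerD //.
  by rewrite vnormB; move: v; near: f; exact: Llim.
apply/cvg_ex; exists (Bop Lbop); apply/cvgrPdistC_le => e e0.
near=> f; apply: opnorm_le => v v1.
apply: (@le_trans _ _ (e * N v)); last by rewrite ler_piMr // ltW.
by move: v {v1}; near: f; exact: Llim.
Unshelve. all: by end_near. Qed.

HB.instance Definition _ := Uniform_isComplete.Build (bop N) bop_complete.

End Completeness.

(** * Paravectors and the Euclidean norm of the Clifford algebra *)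

(** The off-diagonal terms cancel in pairs; this computes the square of a vector
whose basis elements anticommute, for Clifford numbers and for operators alike. *)
Lemma sum_anticomm (U : nmodType) n (F : 'I_n -> 'I_n -> U) :
  (forall j k, j != k -> F j k + F k j = 0) ->
  \sum_j \sum_k F j k = \sum_j F j j.
Proof.
move=> FN.
have split_k j : \sum_k F j k = F j j +
    (\sum_(k < n | (k < j)%N) F j k + \sum_(k < n | (j < k)%N) F j k).
  rewrite (bigD1 j) //= (bigID (fun k : 'I_n => (k < j)%N)) /=.
  congr (_ + (_ + _)); apply: eq_bigl => k; rewrite -val_eqE /=;
    by case: ltngtP.
under eq_bigr do rewrite split_k.
rewrite !big_split /= [X in _ + (_ + X)](exchange_big_dep predT) //= -big_split.
rewrite [X in _ + X]big1 ?addr0 // => j _.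
rewrite -big_split big1 //= => k kj; apply: FN.
by rewrite -val_eqE gtn_eqF.
Qed.

Section CliffordNorm.
Context {R : realType} {n : nat}.
Implicit Types (a b : cliff R n) (s : 'rV[R]_n.+1).

Lemma clgen_mulE l a C :
  (clgen R l * a) C = esign R [set l]%SET (symd [set l]%SET C) * a (symd [set l]%SET C).
Proof.
rewrite [LHS]clmulE (bigD1 [set l]%SET) //= big1 ?addr0.
  by rewrite ffunE eqxx mul1r.
by move=> A /negbTE A0; rewrite ffunE A0 mul0r mulr0.
Qed.

Definition cldot a b : R := \sum_A a A * b A.

Lemma cldotC a b : cldot a b = cldot b a.
Proof. by apply: eq_bigr => A _; rewrite mulrC. Qed.

Lemma cldotDl a b c : cldot (a + b) c = cldot a c + cldot b c.
Proof. by rewrite -big_split; apply: eq_bigr => A _; rewrite ffunE mulrDl. Qed.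

Lemma cldotZl k a b : cldot (k *: a) b = k * cldot a b.
Proof. by rewrite mulr_sumr; apply: eq_bigr => A _; rewrite ffunE -mulrA. Qed.

Lemma cldotDr a b c : cldot a (b + c) = cldot a b + cldot a c.
Proof. by rewrite !(cldotC a) cldotDl. Qed.

Lemma cldotZr k a b : cldot a (k *: b) = k * cldot a b.
Proof. by rewrite !(cldotC a) cldotZl. Qed.

Lemma cldot_sumr I (r : seq I) (P : pred I) a (F : I -> cliff R n) :
  cldot a (\sum_(i <- r | P i) F i) = \sum_(i <- r | P i) cldot a (F i).
Proof.
apply: (big_morph (cldot a)); first by move=> b c; exact: cldotDr.
by rewrite -(scale0r (0 : cliff R n)) cldotZr mul0r.
Qed.

(** Multiplication by a generator permutes the basis up to signs and squares to -1,
so it is orthogonal and skew. *)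
Lemma cldot_clgen l a b : cldot (clgen R l * a) b = - cldot a (clgen R l * b).
Proof.
rewrite /cldot (reindex_inj (inv_inj (symdK [set l]%SET))) -sumrN /=.
apply: eq_bigr => A _; rewrite !clgen_mulE symdK.
have := esign_cocycle R [set l]%SET [set l]%SET A.
rewrite symdd esign0s mulr1.
have -> : esign R [set l]%SET [set l]%SET = -1.
  by rewrite /esign /inv_count !big_set1 leqnn expr1.
set u := esign _ _ _; set v := esign _ _ _ => uvN.
have u2 : u * u = 1 by rewrite /u /esign -expr2 sqrr_sign.
have v2 : v * v = 1 by rewrite /v /esign -expr2 sqrr_sign.
have <- : - u = v by rewrite -[LHS]mulN1r uvN mulrAC -[RHS]mul1r -u2; ring.
by ring.
Qed.

Definition pv_vec s : cliff R n := \sum_(j < n) s 0 (lift ord0 j) *: clgen R j.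

Lemma pvE s : pv s = (s 0 ord0)%:A + pv_vec s. Proof. by []. Qed.

Lemma pv_vec_sqr s :
  pv_vec s * pv_vec s = (- \sum_(j < n) s 0 (lift ord0 j) ^+ 2)%:A.
Proof.
rewrite /pv_vec mulr_suml; under eq_bigr do rewrite mulr_sumr.
rewrite sum_anticomm => [|j k jk]; last first.
  rewrite -!(scalerAl, scalerAr) !scalerA [X in _ + X *: _]mulrC -scalerDr.
  by rewrite clgen_anticomm // scaler0.
rewrite -sumrN scaler_suml; apply: eq_bigr => j _.
by rewrite -scalerAl -scalerAr -expr2 clgen_sqr scalerA scalerN scaleNr.
Qed.

Lemma cldot_pv_vec s a b : cldot (pv_vec s * a) b = - cldot a (pv_vec s * b).
Proof.
rewrite cldotC /pv_vec !mulr_suml !cldot_sumr -sumrN; apply: eq_bigr => j _.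
by rewrite -!scalerAl !cldotZr cldotC cldot_clgen mulrN.
Qed.

Lemma enorm_sqr s : enorm s ^+ 2 = s 0 ord0 ^+ 2 + \sum_(j < n) s 0 (lift ord0 j) ^+ 2.
Proof.
rewrite /enorm sqr_sqrtr; first by rewrite big_ord_recl.
by apply: sumr_ge0 => j _; exact: sqr_ge0.
Qed.

(** Multiplication by the vector part of s is skew with square minus its squared
length, so the cross terms with the scalar part cancel. *)
Lemma cldot_pv s a : cldot (pv s * a) (pv s * a) = enorm s ^+ 2 * cldot a a.
Proof.
rewrite pvE mulrDl mulr_algl cldotDl !cldotDr !cldotZl !cldotZr.
rewrite !cldot_pv_vec (mulrA (pv_vec s)) pv_vec_sqr mulr_algl cldotZr.
by rewrite enorm_sqr; ring.
Qed.

(** The inverse is the conjugate paravector divided by the squared length. *)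
Lemma pv_unit s : 0 < enorm s -> pv s \is a GRing.unit.
Proof.
move=> s0; have e0 : enorm s ^+ 2 != 0 by rewrite gt_eqF ?exprn_gt0.
have comm_vec : GRing.comm (s 0 ord0)%:A (pv_vec s).
  by rewrite /GRing.comm mulr_algl mulr_algr.
have prodE : ((s 0 ord0)%:A - pv_vec s) * pv s = (enorm s ^+ 2)%:A.
  rewrite pvE mulrBl !mulrDr -comm_vec opprD addrA addrK pv_vec_sqr.
  by rewrite enorm_sqr scaleNr opprK scalerDl mulr_algl scalerA expr2.
have prodE' : pv s * ((s 0 ord0)%:A - pv_vec s) = (enorm s ^+ 2)%:A.
  rewrite pvE mulrBr !mulrDl -comm_vec opprD addrA addrK pv_vec_sqr.
  by rewrite enorm_sqr scaleNr opprK scalerDl mulr_algl scalerA expr2.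
apply/unitrP; exists ((enorm s ^+ 2)^-1 *: ((s 0 ord0)%:A - pv_vec s)).
by rewrite -scalerAl -scalerAr prodE prodE' scalerA mulVf // scale1r.
Qed.

(** A similitude of ratio |s| has an inverse of ratio 1/|s|; applied p times to 1, of
Euclidean norm 1, it gives the norm of s^-p, hence a bound for each coordinate. *)
Lemma pv_expVn_coord s p A : 0 < enorm s ->
  `|((pv s)^-1 ^+ p) A| <= (enorm s)^-1 ^+ p.
Proof.
move=> s0; have su := pv_unit s0; have sn0 : enorm s != 0 by rewrite gt_eqF.
have dotE : cldot ((pv s)^-1 ^+ p) ((pv s)^-1 ^+ p) = ((enorm s)^-1 ^+ p) ^+ 2.
  elim: p => [|p IH].
    rewrite !expr0 expr1n /cldot (bigD1 finset.set0) //= big1 => [|B /negbTE B0].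
      by rewrite addr0 -cle0 ffunE eqxx mulr1.
    by rewrite -cle0 ffunE B0 mul0r.
  apply: (@mulfI _ (enorm s ^+ 2)); first by rewrite expf_neq0.
  rewrite -cldot_pv exprS mulVKr // IH (exprS (enorm s)^-1) (exprMn _ (enorm s)^-1).
  by rewrite mulrA -exprMn mulfV // expr1n mul1r.
have t0 : 0 <= (enorm s)^-1 ^+ p by rewrite exprn_ge0 // invr_ge0 ltW.
rewrite -(ler_pXn2r (ltn0Sn 1)) ?nnegrE // real_normK ?num_real // -dotE.
rewrite /cldot (bigD1 A) //=.
by rewrite -expr2 lerDl sumr_ge0 // => B _; rewrite -expr2 sqr_ge0.
Qed.

End CliffordNorm.

(** * Clifford numbers and multiplications as operators *)

Section OperatorAlgebra.
Context {R : realType} {V : completeNormedModType R} {n : nat}.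
Context (N : Vn_norm V n).
Implicit Types (f g : bop N) (a b : cliff R n) (v : Vn V n).
Local Notation op := (clop N).

Lemma lactM a b v : lact (a * b) v = lact a (lact b v).
Proof.
apply/ffunP => D; rewrite !lactE.
transitivity (\sum_A \sum_B ((esign R A (symd A D) * a A) *:
   ((esign R B (symd B (symd A D)) * b B) *: v (symd B (symd A D))))).
  under eq_bigr => X _ do rewrite clmulE mulr_sumr scaler_suml.
  rewrite exchange_big; apply: eq_bigr => A _ /=.
  rewrite (reindex_inj (inv_inj (symdK A))); apply: eq_bigr => B _ /=.
  rewrite symdK !scalerA.
  have -> : symd (symd A B) D = symd B (symd A D) by rewrite symdA (symdC A B).
  set Z := symd B (symd A D).
  have -> : symd A D = symd B Z by rewrite symdK.
  have H := esign_cocycle R A B Z; congr (_ *: _).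
  rewrite [RHS]mulrACA -H; ring.
by apply: eq_bigr => A _; rewrite lactE scaler_sumr.
Qed.

Lemma lactZl k a v : lact (k *: a) v = k *: lact a v.
Proof.
apply/ffunP => D; rewrite [RHS]ffunE !lactE scaler_sumr.
by apply: eq_bigr => A _; rewrite ffunE scalerA mulrCA.
Qed.

Lemma lact1 v : lact 1 v = v.
Proof.
apply/ffunP => D; rewrite lactE (bigD1 finset.set0) //= sym0d esign0s.
rewrite big1 ?addr0; first by rewrite -cle0 ffunE eqxx mul1r scale1r.
by move=> A /negbTE A0; rewrite -cle0 ffunE A0 mulr0 scale0r.
Qed.

Lemma clopM a b : op (a * b) = op a * op b.
Proof. by apply: bop_ext => v; exact: lactM. Qed.

Lemma clop1 : op 1 = 1.
Proof. by apply: bop_ext => v; exact: lact1. Qed.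

Lemma clopD a b : op (a + b) = op a + op b.
Proof. by apply: bop_ext => v; exact: lactDl. Qed.

Lemma clopZ k a : op (k *: a) = k *: op a.
Proof. by apply: bop_ext => v; exact: lactZl. Qed.

Lemma clop_bound : exists K : R, forall a, `|op a| <= K * \sum_A `|a A|.
Proof.
have [c c0 cN] := vnorm_lb N; have [d d0 dN] := vnorm_ub N.
exists (d / c) => a; apply: opnorm_le => v v1.
rewrite (le_trans (dN _)) // -mulrA ler_pM2l // (le_trans (lact_l1_bound _ _)) //.
rewrite mulrC ler_wpM2r ?sumr_ge0 // -[leRHS]mulr1 ler_pdivlMl //.
exact: le_trans (cN v) v1.
Qed.

Lemma clop_pv_bound (s : 'rV[R]_n.+1) : 0 < enorm s ->
  exists K : R, forall p, `|op ((pv s)^-1 ^+ p)| <= K * (enorm s)^-1 ^+ p.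
Proof.
move=> s0; have [K KP] := clop_bound.
have K0 : 0 <= K.
  have := le_trans (normr_ge0 _) (KP 1).
  rewrite pmulr_lge0 // (bigD1 finset.set0) //= -cle0 ffunE eqxx normr1.
  by rewrite ltr_pwDl // sumr_ge0.
exists (K * #|{set 'I_n}|%:R) => p; apply: (le_trans (KP _)).
rewrite -mulrA ler_wpM2l // mulr_natl -sumr_const; apply: ler_sum => A _.
exact: pv_expVn_coord.
Qed.

Lemma bopZr k f g : f * (k *: g) = k *: (f * g).
Proof. by apply: bop_ext => v; rewrite bopZ [LHS]bop_scale. Qed.

Lemma bopZl k f g : (k *: f) * g = k *: (f * g).
Proof. by apply: bop_ext. Qed.

(** Left and right multiplication as linear maps of B(V_n): although f and g need not
commute, [lmulop f] and [rmulop g] do. *)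
Definition lmulop f g : bop N := f * g.
Definition rmulop f g : bop N := g * f.

Lemma lmulop_linear f : linear (lmulop f).
Proof. by move=> k u v; rewrite /lmulop mulrDr bopZr. Qed.

Lemma rmulop_linear f : linear (rmulop f).
Proof. by move=> k u v; rewrite /rmulop mulrDl bopZl. Qed.

HB.instance Definition _ f :=
  GRing.isLinear.Build R (bop N) (bop N) _ (lmulop f) (lmulop_linear f).
HB.instance Definition _ f :=
  GRing.isLinear.Build R (bop N) (bop N) _ (rmulop f) (rmulop_linear f).

Lemma lmulop_continuous f : continuous (lmulop f).
Proof.
apply: (@bounded_linear_continuous _ _ _ (lmulop f)); apply/linear_boundedP.
by near=> r; move=> g; rewrite (le_trans (normopM _ _)) // ler_wpM2r //.
Unshelve. all: by end_near. Qed.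

Lemma rmulop_continuous f : continuous (rmulop f).
Proof.
apply: (@bounded_linear_continuous _ _ _ (rmulop f)); apply/linear_boundedP.
by near=> r; move=> g; rewrite (le_trans (normopM _ _)) // mulrC ler_wpM2r //.
Unshelve. all: by end_near. Qed.

End OperatorAlgebra.

(** * The paravector operator and its conjugate *)

Section ParavectorOperators.
Context {R : realType} {V : completeNormedModType R} {n : nat}.
Context (N : Vn_norm V n) (T : BC01 V n).
Local Notation op := (clop N).
Local Notation Tc := (component_op N T).
Local Notation A := (pvop N T).
Local Notation Abar := (pvop_conj N T).

(** A component acts on the coordinates and a Clifford number permutes and scales
them. *)
Lemma clop_component_comm a l : GRing.comm (op a) (Tc l).
Proof.
apply: bop_ext => v; apply/ffunP => C.
transitivity (lact a (cwise (component T l) v) C); first by [].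
transitivity (component T l (lact a v C)); last by rewrite [RHS]ffunE.
by rewrite !lactE linear_sum; apply: eq_bigr => B _; rewrite linearZ ffunE.
Qed.

Lemma component_comm l m : GRing.comm (Tc l) (Tc m).
Proof.
apply: bop_ext => v; apply/ffunP => C.
by rewrite [LHS]ffunE [RHS]ffunE !ffunE component_commute.
Qed.

Definition pvop_vec : bop N := \sum_(l < n) op (clgen R l) * Tc (lift ord0 l).

Lemma component_vec_comm l : GRing.comm (Tc l) pvop_vec.
Proof.
apply: commr_sum => m _; apply: commrM; last exact: component_comm.
exact/commr_sym/clop_component_comm.
Qed.

Lemma pvop_vec_sqr :
  pvop_vec * pvop_vec = - \sum_(l < n) Tc (lift ord0 l) * Tc (lift ord0 l).
Proof.
have prodE l m : op (clgen R l) * Tc (lift ord0 l) *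
    (op (clgen R m) * Tc (lift ord0 m)) =
    op (clgen R l * clgen R m) * (Tc (lift ord0 l) * Tc (lift ord0 m)).
  by rewrite clopM -!mulrA; congr (_ * _); rewrite !mulrA clop_component_comm.
rewrite /pvop_vec mulr_suml; under eq_bigr do rewrite mulr_sumr.
rewrite sum_anticomm => [|l m lm]; last first.
  rewrite !prodE component_comm -mulrDl -clopD clgen_anticomm //.
  by rewrite -(scale0r 1) clopZ scale0r mul0r.
rewrite -sumrN; apply: eq_bigr => l _; rewrite prodE -expr2 clgen_sqr.
by rewrite -scaleN1r clopZ clop1 scaleN1r mulN1r.
Qed.

Lemma pvopE : A = Tc ord0 + pvop_vec. Proof. by []. Qed.
Lemma pvop_conjE : Abar = Tc ord0 - pvop_vec. Proof. by []. Qed.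

Lemma pvop_trace : A + Abar = Tc ord0 + Tc ord0.
Proof. by rewrite pvopE pvop_conjE addrACA subrr addr0. Qed.

(** T Tbar = T_0^2 - w^2 for the vector part w of T, and w^2 is minus the sum of the
T_l^2 because the e_l anticommute and the T_l commute. *)
Lemma pvop_norm : A * Abar = \sum_(l < n.+1) Tc l * Tc l.
Proof.
rewrite pvopE pvop_conjE mulrDl !mulrBr -component_vec_comm addrA subrK.
by rewrite pvop_vec_sqr opprK big_ord_recl.
Qed.

Lemma pvop_conj_comm : A * Abar = Abar * A.
Proof.
rewrite pvopE pvop_conjE; apply: commrB; apply: commr_sym; apply: commrD => //.
- exact: component_vec_comm.
- exact/commr_sym/component_vec_comm.
Qed.

Lemma pvop_trace_comm f : (forall l, GRing.comm f (Tc l)) -> GRing.comm f (A + Abar).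
Proof. by move=> fT; rewrite pvop_trace; apply: commrD. Qed.

Lemma pvop_norm_comm f : (forall l, GRing.comm f (Tc l)) -> GRing.comm f (A * Abar).
Proof. by move=> fT; rewrite pvop_norm; apply: commr_sum => l _; apply: commrM. Qed.

(** The main involution of the Clifford algebra, e_l |-> - e_l, extended to V_n. *)
Definition grade (v : Vn V n) : Vn V n := [ffun B : {set 'I_n} => (-1) ^+ #|B| *: v B].

Lemma gradeK : involutive grade.
Proof.
move=> v; apply/ffunP => B; rewrite !ffunE scalerA -expr2 sqrr_sign.
by rewrite scale1r.
Qed.

Lemma gradeD : {morph grade : u v / u + v}.
Proof. by move=> u v; apply/ffunP => B; rewrite !ffunE scalerDr. Qed.

Lemma grade_component l v : grade (Tc l v) = Tc l (grade v).
Proof. by apply/ffunP => B; rewrite !ffunE linearZ. Qed.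

Lemma odd_card_symd1 l (C : {set 'I_n}) :
  odd #|symd [set l]%SET C| = ~~ odd #|C|.
Proof.
rewrite (cardsD1 l C) (cardsD1 l (symd _ _)) !inE eqxx /=.
have -> : (symd [set l] C :\ l = C :\ l)%SET.
  by apply/setP => j; rewrite !inE; case: eqP.
by case: (l \in C); rewrite /= ?negbK.
Qed.

Lemma grade_clgen l v :
  grade (op (clgen R l) v) = - op (clgen R l) (grade v).
Proof.
have genE w C : lact (clgen R l) w C =
    esign R [set l]%SET (symd [set l]%SET C) *: w (symd [set l]%SET C) :> V.
  rewrite lactE (bigD1 [set l]%SET) //= big1 ?addr0.
    by rewrite ffunE eqxx mulr1.
  by move=> B /negbTE B0; rewrite ffunE B0 mulr0 scale0r.
apply/ffunP => C; rewrite ffunE [RHS]ffunE.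
rewrite -[op _ v]/(lact _ v) -[op _ (grade v)]/(lact _ _) !genE ffunE !scalerA.
have -> : (-1) ^+ #|symd [set l]%SET C| = - (-1) ^+ #|C| :> R.
  by rewrite -signr_odd odd_card_symd1 signrN signr_odd.
by rewrite mulrN scaleNr opprK mulrC.
Qed.

(** T is odd in the e_l except for T_0, and the involution changes the sign of each
e_l: it intertwines T and Tbar. *)
Lemma grade_pvop v : grade (A v) = Abar (grade v).
Proof.
have sumE (I : finType) (F : I -> bop N) (w : Vn V n) : (\sum_i F i) w = \sum_i F i w.
  by apply: (big_morph (fun f : bop N => f w)).
have grade0 : grade 0 = 0.
  by apply/ffunP => B; rewrite !ffunE scaler0.
rewrite pvopE pvop_conjE !bopD gradeD grade_component; congr (_ + _).
rewrite -[(- _ : bop N) _]/(- (pvop_vec (grade v))) /pvop_vec !sumE.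
rewrite (big_morph _ gradeD grade0) -sumrN; apply: eq_bigr => l _.
by rewrite /= grade_clgen grade_component.
Qed.

Lemma pvop_conj_expE k v : (Abar ^+ k) v = grade ((A ^+ k) (grade v)).
Proof.
elim: k v => [|k IH] v; first by rewrite !expr0 gradeK.
by rewrite !exprS -[LHS]/(Abar ((Abar ^+ k) v)) IH -grade_pvop.
Qed.

(** Tbar^k is conjugate to T^k by the grade involution, whose bound is independent
of k.  The involution is not right linear, so this is an estimate on vectors and
not a conjugation inside B(V_n). *)
Lemma pvop_conjX_bound : exists K : R, forall k, `|Abar ^+ k| <= K * `|A| ^+ k.
Proof.
have [K K0 gradeN_le] : exists2 K, 0 <= K & forall v, N (grade v) <= K * N v.
  have [c c0 cN] := vnorm_lb N; have [d d0 dN] := vnorm_ub N.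
  exists (d / c) => [|v]; first by rewrite divr_ge0 ?ltW.
  rewrite (le_trans (dN _)) // -mulrA ler_pM2l // ler_pdivlMl //.
  rewrite (le_trans _ (cN v)) // ler_pM2l // ler_sum // => B _.
  by rewrite ffunE normrZ normrX normrN1 expr1n mul1r.
exists (K * K) => k; apply: opnorm_le => v v1; rewrite pvop_conj_expE.
rewrite (le_trans (gradeN_le _)) // -mulrA ler_wpM2l //.
rewrite (le_trans (opnorm_ub _ _)) // mulrC ler_pM ?opnorm_ge0 ?vnorm_ge0 //.
  by rewrite (le_trans (gradeN_le v)) // -[leRHS]mulr1 ler_wpM2l.
exact: normopX.
Qed.

End ParavectorOperators.

(** * Inverting the quadratic factor by the series *)

(** The elements S i j play the part of (s - A)^-i (s - B)^-j, with the powers of s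
written on the right. *)
Section TwoFactors.
Variables (U : pzRingType) (A B s : U).
Hypothesis AB : GRing.comm A B.
Let Q := s * s - (A + B) * s + A * B.

(** If X commutes with A + B and A B, then X Q is
(X s - A X) s - B (X s - A X), the factorisation of Q seen through the commuting
maps A *, B * and * s. *)
Lemma factor_step X Y Z :
  GRing.comm X (A + B) -> GRing.comm X (A * B) ->
  X * s = A * X + Y -> Y * s = B * Y + Z -> X * Q = Z.
Proof.
move=> Xtr Xnm Xs Ys; pose P := A * X + Y.
have Xss : X * (s * s) = A * P + (B * Y + Z) by rewrite mulrA Xs mulrDl -mulrA Xs Ys.
have Xts : X * ((A + B) * s) = A * P + (B * (A * X) + B * Y).
  by rewrite mulrA Xtr -mulrA Xs mulrDl [B * _]mulrDr.
rewrite /Q mulrDr mulrBr Xss Xts Xnm AB -mulrA opprD addrACA subrr add0r.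
by rewrite addrAC opprD addrA addrK addrAC subrr add0r.
Qed.

Variable S : nat -> nat -> U.
Hypothesis S00 : S 0 0 = 1.
Hypothesis SA : forall i j, S i.+1 j * s = A * S i.+1 j + S i j.
Hypothesis SB : forall i j, S i j.+1 * s = B * S i j.+1 + S i j.
Hypothesis S_tr : forall i j, GRing.comm (S i j) (A + B).
Hypothesis S_nm : forall i j, GRing.comm (S i j) (A * B).

Lemma factor_inv : S 1 1 * Q = 1.
Proof. by rewrite -S00; apply: (factor_step (Y := S 0 1)). Qed.

Lemma factor_expr h : S h.+1 h * Q ^+ h.+1 = s - B.
Proof.
elim: h => [|h IH].
  rewrite expr1; apply: (factor_step (Y := 1)) => //; last first.
    by rewrite mul1r mulr1 addrC subrK.
  by rewrite SA S00.
rewrite exprS mulrA -IH; congr (_ * _).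
exact: (factor_step (Y := S h.+1 h.+1)).
Qed.

End TwoFactors.

Lemma expr_inverse (U : pzRingType) (x y : U) k : x * y = 1 -> x ^+ k * y ^+ k = 1.
Proof.
move=> xy; elim: k => [|k IH]; first by rewrite !expr0 mulr1.
by rewrite exprSr exprS mulrA -(mulrA _ x) xy mulr1.
Qed.

(** The mirror image of the argument takes place in the converse ring, and produces
powers of Q computed there. *)
Lemma converse_expr (U : pzRingType) (x : U) k : (x : U^c) ^+ k = x ^+ k.
Proof. by elim: k => [|k IH]; rewrite ?expr0 // exprS exprSr IH. Qed.

(** Here f, g, c stand for T, Tbar and s, and e p for s^-p.  The two families Wr and
Wl carry the powers of s on the right and on the left respectively. *)
Section OneSidedSeries.
Context {R : realType} {V : completeNormedModType R} {n : nat}.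
Context (N : Vn_norm V n).
Variables (f g c : bop N) (e : nat -> bop N) (C D r t : R).
Hypotheses (e0 : e 0 = 1) (eSc : forall p, e p.+1 * c = e p).
Hypothesis ceS : forall p, c * e p.+1 = e p.
Hypothesis fg : GRing.comm f g.
Hypotheses (tr_c : GRing.comm (f + g) c) (tr_e : forall p, GRing.comm (f + g) (e p)).
Hypothesis nm_e : forall p, GRing.comm (f * g) (e p).
Hypotheses (r0 : 0 <= r) (t0 : 0 <= t) (rt1 : r * t < 1).
Hypothesis fg_le : forall a b, `|f ^+ a * g ^+ b| <= C * r ^+ (a + b).
Hypothesis e_le : forall p, `|e p| <= D * t ^+ p.

Let Wr a b p : bop N := f ^+ a * g ^+ b * e p.
Let Wl a b p : bop N := e p * f ^+ a * g ^+ b.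

Let Wr_le a b p : `|Wr a b p| <= C * D * r ^+ (a + b) * t ^+ p.
Proof.
apply: (le_trans (normopM _ _)); rewrite -mulrA mulrACA.
by rewrite ler_pM // mulrA.
Qed.

Let Wl_le a b p : `|Wl a b p| <= C * D * r ^+ (a + b) * t ^+ p.
Proof.
rewrite /Wl -mulrA (le_trans (normopM _ _)) // mulrC -mulrA mulrACA.
by rewrite ler_pM // mulrA.
Qed.

Lemma dsum_comm (W : nat -> nat -> nat -> bop N) (z : bop N) i j :
  cvgn (series (dterm W i j)) ->
  (forall a b p, GRing.comm z (W a b p)) -> GRing.comm z (dsum W i j).
Proof.
move=> cW zW; rewrite /GRing.comm.
have lz : z * series (dterm W i j) M @[M --> \oo] --> z * dsum W i j.
  exact: (@continuous_cvg _ _ _ _ _ _ (lmulop z) _ (@lmulop_continuous _ _ _ _ z _) cW).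
apply: (cvg_unique _ lz) => //.
rewrite (_ : (fun M => _) = (fun M => series (dterm W i j) M * z)).
  exact: (@continuous_cvg _ _ _ _ _ _ (rmulop z) _ (@rmulop_continuous _ _ _ _ z _) cW).
apply/funext => M; apply: commr_sum => k _; apply: commr_sum => a _.
by rewrite /GRing.comm bopZr bopZl zW.
Qed.

Let Q := c * c - (f + g) * c + f * g.

Let trf : GRing.comm (f + g) f. Proof. by apply/commr_sym/commrD. Qed.
Let trg : GRing.comm (f + g) g.
Proof. by apply/commr_sym/commrD => //; exact/commr_sym. Qed.
Let nmf : GRing.comm (f * g) f. Proof. by apply/commr_sym/commrM. Qed.
Let nmg : GRing.comm (f * g) g.
Proof. by apply/commr_sym/commrM => //; exact/commr_sym. Qed.

Let right_sum :
  dsum Wr 1 1 * Q = 1 /\ forall h, dsum Wr h.+1 h * Q ^+ h.+1 = c - g.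
Proof.
have xW a b p : lmulop f (Wr a b p) = Wr a.+1 b p.
  by rewrite /lmulop /Wr exprS !mulrA.
have yW a b p : lmulop g (Wr a b p) = Wr a b.+1 p.
  rewrite /lmulop /Wr exprS !mulrA; congr (_ * _ * _).
  by apply: commrX; exact/commr_sym.
have sW a b p : rmulop c (Wr a b p.+1) = Wr a b p.
  by rewrite /rmulop /Wr -mulrA eSc.
have Sf := dsumSl r0 t0 rt1 Wr_le (@lmulop_continuous _ _ _ _ f)
  (@rmulop_continuous _ _ _ _ c) xW sW.
have Sg := dsumSr r0 t0 rt1 Wr_le (@lmulop_continuous _ _ _ _ g)
  (@rmulop_continuous _ _ _ _ c) yW sW.
have S00 : dsum Wr 0 0 = 1 by rewrite dsum00 /Wr e0 !expr0 !mulr1.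
have S_comm z i j : GRing.comm z f -> GRing.comm z g ->
    (forall p, GRing.comm z (e p)) -> GRing.comm (dsum Wr i j) z.
  move=> zf zg zc; apply: commr_sym; apply: dsum_comm.
    exact: is_cvg_dterm r0 t0 rt1 Wr_le i j.
  by move=> a b p; do !apply: commrM => //; exact: commrX.
have S_tr i j := S_comm _ i j trf trg tr_e.
have S_nm i j := S_comm _ i j nmf nmg nm_e.
split; first exact: (@factor_inv (bop N) f g c fg (dsum Wr) S00 Sf Sg S_tr S_nm).
exact: (@factor_expr (bop N) f g c fg (dsum Wr) S00 Sf Sg S_tr S_nm).
Qed.

(** In the converse ring right multiplication by f becomes left multiplication, so
this is the previous computation there; commutation of f + g with c and of f with
g identifies Q with its converse. *)
Let left_sum :
  Q * dsum Wl 1 1 = 1 /\ forall h, Q ^+ h.+1 * dsum Wl h.+1 h = c - g.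
Proof.
have xW a b p : rmulop f (Wl a b p) = Wl a.+1 b p.
  rewrite /rmulop /Wl exprSr -!mulrA; congr (_ * (_ * _)).
  by apply/commr_sym/commrX.
have yW a b p : rmulop g (Wl a b p) = Wl a b.+1 p.
  by rewrite /rmulop /Wl exprSr -!mulrA.
have sW a b p : lmulop c (Wl a b p.+1) = Wl a b p.
  by rewrite /lmulop /Wl !mulrA ceS.
have Sf := dsumSl r0 t0 rt1 Wl_le (@rmulop_continuous _ _ _ _ f)
  (@lmulop_continuous _ _ _ _ c) xW sW.
have Sg := dsumSr r0 t0 rt1 Wl_le (@rmulop_continuous _ _ _ _ g)
  (@lmulop_continuous _ _ _ _ c) yW sW.
have S00 : dsum Wl 0 0 = 1 by rewrite dsum00 /Wl e0 !expr0 !mulr1.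
have S_comm z i j : GRing.comm z f -> GRing.comm z g ->
    (forall p, GRing.comm z (e p)) -> GRing.comm z (dsum Wl i j).
  move=> zf zg zc; apply: dsum_comm.
    exact: is_cvg_dterm r0 t0 rt1 Wl_le i j.
  by move=> a b p; do !apply: commrM => //; exact: commrX.
have S_tr i j : @GRing.comm (bop N)^c (dsum Wl i j) ((f : (bop N)^c) + g).
  exact: (S_comm (f + g)).
have S_nm i j : @GRing.comm (bop N)^c (dsum Wl i j) ((f : (bop N)^c) * g).
  rewrite -[X in GRing.comm _ X]/(g * f : bop N) -fg; exact: (S_comm (f * g)).
have QE : (c : (bop N)^c) * c - ((f : (bop N)^c) + g) * c + (f : (bop N)^c) * g = Q.
  by rewrite /Q fg tr_c.
have fgV : @GRing.comm (bop N)^c f g by exact/esym.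
split.
  have := @factor_inv (bop N)^c f g c fgV (dsum Wl) S00 Sf Sg S_tr S_nm.
  by rewrite QE.
move=> h.
have := @factor_expr (bop N)^c f g c fgV (dsum Wl) S00 Sf Sg S_tr S_nm h.
by rewrite QE converse_expr.
Qed.

(** The left inverse of Q found on one side and the right inverse found on the other
must coincide, and multiplying by its power solves for S (h+1) h. *)
Lemma resolvent_power_series h :
  exists Qinv : bop N,
    [/\ Q * Qinv = 1, Qinv * Q = 1,
        series (dterm Wr h.+1 h) @ \oo --> (c - g) * Qinv ^+ h.+1 &
        series (dterm Wl h.+1 h) @ \oo --> Qinv ^+ h.+1 * (c - g)].
Proof.
have [rQ rS] := right_sum; have [lQ lS] := left_sum.
have QV : dsum Wr 1 1 = dsum Wl 1 1.
  by rewrite -[LHS]mulr1 -lQ mulrA rQ mul1r.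
exists (dsum Wr 1 1); split=> //; first by rewrite QV.
- rewrite -(rS h) -mulrA expr_inverse ?mulr1; last by rewrite QV.
  exact: dsum_cvg r0 t0 rt1 Wr_le _ _.
- rewrite -(lS h) mulrA expr_inverse // mul1r.
  exact: dsum_cvg r0 t0 rt1 Wl_le _ _.
Qed.

End OneSidedSeries.

(** * The coefficients and the theorem *)

(** With l = b + 1 and m = a + b + 2h the four factorials of K regroup into two
binomial coefficients and a factor h! (h-1)!, which the factor h of K completes to
the h!^2 of gamma_n. *)
Lemma Kcoef_negbin (R : realType) (h a b : nat) : (0 < h)%N ->
  Kcoef R b.+1 (a + b + 2 * h) h =
  gamma_n R (2 * h + 1) * (negbin h.+1 a * negbin h b)%:R.
Proof.
case: h => // h _; rewrite /Kcoef /gamma_n.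
have -> : (a + b + 2 * h.+1 + 1 - b.+1 - h.+1 = a + h.+1)%N by lia.
have -> : (a + b + 2 * h.+1 + 1 - b.+1 - 2 * h.+1 = a)%N by lia.
have -> : (b.+1 + h.+1 - 2 = b + h)%N by lia.
have -> : (b.+1 - 1 = b)%N by lia.
rewrite addnK mulKn // exprM.
have binE i k : (negbin k.+1 i * (i`! * k`!) = (i + k)`!)%N.
  by rewrite /negbin addnS /= -(bin_fact (leq_addr k i)) addnC addnK.
rewrite -(binE a) -(binE b) factS !natrM.
have -> : 2 ^+ 2 = 4 :> R by ring.
by field; rewrite !pnatr_eq0 -!lt0n !fact_gt0.
Qed.

(** Reindexing by b = l - 1, k = m - 2h: the inner sum then runs over the exponent of
Tbar, while [dterm] runs over that of T, whence the flip in the proof. *)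
Section Rearrangement.
Context {R : realType} {E : lmodType R} (h : nat).
Hypothesis h0 : (0 < h)%N.
Variables (W : nat -> nat -> nat -> E).

Lemma Kcoef_sum_dterm M :
  \sum_(2 * h <= m < M) \sum_(1 <= l < m - 2 * h + 2)
     Kcoef R l m h *: W (m - 2 * h + 1 - l)%N (l - 1)%N (m + 1)%N =
  gamma_n R (2 * h + 1) *: series (dterm W h.+1 h) (M - 2 * h)%N.
Proof.
rewrite -[X in index_iota X]add0n big_addn /series /= scaler_sumr.
apply: eq_bigr => k _; rewrite addnK addn2 big_add1 /= big_mkord.
rewrite dterm_flip /dterm scaler_sumr; apply: eq_bigr => b _.
have le_bk : (b <= k)%N by rewrite -ltnS.
rewrite scalerA [(negbin h _ * _)%N]mulnC -Kcoef_negbin // subnK //.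
by congr (_ *: W _ _ _); lia.
Qed.

End Rearrangement.

Lemma cvg_Kcoef_sum (R : realType) (E : normedModType R) (W : nat -> nat -> nat -> E)
    (h : nat) (l : E) : (0 < h)%N ->
  series (dterm W h.+1 h) @ \oo --> l ->
  \sum_(2 * h <= m < M) \sum_(1 <= l < m - 2 * h + 2)
     Kcoef R l m h *: W (m - 2 * h + 1 - l)%N (l - 1)%N (m + 1)%N
   @[M --> \oo] --> gamma_n R (2 * h + 1) *: l.
Proof.
move=> h0 Wl.
rewrite (_ : (fun M => _) = (fun M => gamma_n R (2 * h + 1) *:
    series (dterm W h.+1 h) (M - 2 * h)%N)).
  by apply: cvgZl_tmp; have := Wl; rewrite -(cvg_centern (2 * h)).
by apply/funext => M; exact: Kcoef_sum_dterm.
Qed.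

Theorem theorem3p9 (R : realType) (V : completeNormedModType R) (n : nat)
    (N : Vn_norm V n) (T : BC01 V n) (s : 'rV[R]_n.+1) :
  (3 <= n)%N -> odd n ->
  let h := ((n - 1) %/ 2)%N in
  let A := pvop N T in
  let Abar := pvop_conj N T in
  let op (a : cliff R n) := clop N a in
  let ps := pv s in
  let Q := op (ps ^+ 2) - (A + Abar) * op ps + A * Abar in
  `|A| < enorm s ->
  exists Qinv : bop N,
    [/\ Q * Qinv = 1,
        Qinv * Q = 1,
        (\sum_(2 * h <= m < M) \sum_(1 <= l < m - 2 * h + 2)
            Kcoef R l m h *:
              (A ^+ (m - 2 * h + 1 - l) * Abar ^+ (l - 1) * op (ps ^- (m + 1))))
          @[M --> \oo]
          --> gamma_n R n *: ((op ps - Abar) * Qinv ^+ (h + 1)) &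
        (\sum_(2 * h <= m < M) \sum_(1 <= l < m - 2 * h + 2)
            Kcoef R l m h *:
              (op (ps ^- (m + 1)) * A ^+ (m - 2 * h + 1 - l) * Abar ^+ (l - 1)))
          @[M --> \oo]
          --> gamma_n R n *: (Qinv ^+ (h + 1) * (op ps - Abar)) ].
Proof.
move=> n3 n_odd h A Abar op ps Q As.
have h0 : (0 < h)%N by rewrite /h divn_gt0 //; lia.
have nE : n = (2 * h + 1)%N by rewrite /h; lia.
have gammaE : gamma_n R n = gamma_n R (2 * h + 1) by rewrite -nE.
have s0 : 0 < enorm s by exact: le_lt_trans As.
have psu : ps \is a GRing.unit by exact: pv_unit.
pose e p := op (ps ^- p).
have e0 : e 0 = 1 by rewrite /e expr0 invr1 /op clop1.
have eSc p : e p.+1 * op ps = e p.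
  by rewrite /e /op -clopM -!exprVn exprSr mulrVK.
have ceS p : op ps * e p.+1 = e p.
  by rewrite /e /op -clopM -!exprVn exprS mulVKr.
have comm_op a l : GRing.comm (op a) (component_op N T l).
  exact: clop_component_comm.
have [K KP] := pvop_conjX_bound N T; have [D DP] := clop_pv_bound N s0.
have AAbar_le a b : `|A ^+ a * Abar ^+ b| <= K * `|A| ^+ (a + b).
  rewrite (le_trans (normopM _ _)) // exprD mulrCA ler_pM //.
  exact: normopX.
have e_le p : `|e p| <= D * (enorm s)^-1 ^+ p by rewrite /e -exprVn.
have tr_op a : GRing.comm (A + Abar) (op a).
  by apply/commr_sym/pvop_trace_comm.
have nm_op a : GRing.comm (A * Abar) (op a).
  by apply/commr_sym/pvop_norm_comm.
have lt1 : `|A| * (enorm s)^-1 < 1 by rewrite ltr_pdivrMr // mul1r.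
have t0 : 0 <= (enorm s)^-1 by rewrite invr_ge0 ltW.
have [Qinv [QQ QV cr cl]] := resolvent_power_series e0 eSc ceS
  (pvop_conj_comm N T) (tr_op _) (fun _ => tr_op _) (fun _ => nm_op _)
  (normr_ge0 A) t0 lt1 AAbar_le e_le h.
have QE : Q = op ps * op ps - (A + Abar) * op ps + A * Abar.
  by rewrite /Q expr2 /op clopM.
exists Qinv; rewrite QE gammaE (addn1 h); split.
- exact: QQ.
- exact: QV.
- exact: (@cvg_Kcoef_sum R (bop N)
    (fun a b p => A ^+ a * Abar ^+ b * e p) h _ h0 cr).
- exact: (@cvg_Kcoef_sum R (bop N)
    (fun a b p => e p * A ^+ a * Abar ^+ b) h _ h0 cl).
Qed.
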